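(* Let $\mathbf{C}$ be the $p$th-degree NURBS curve on $[u_i,u_{i+1}]$ with control points $\mathbf{p}_{i-p},\dots,\mathbf{p}_i$ and weights $\omega_{i-p},\dots,\omega_i$. If the weights $\boldsymbol{\omega}_{\mathbf{j}_0}=\{\omega_j\}_{j\in\mathbf{j}_0}$ tend to $+\infty$ along an approach path with dominant index set $\mathbf{j}_0$, then $\mathbf{C}$ converges in $L^1$ on $[u_i,u_{i+1}]$; that is, there is an integrable function $\mathbf{L}:[u_i,u_{i+1}]\to\mathbb{R}^d$ such that $\int_{u_i}^{u_{i+1}}\|\mathbf{C}(u)-\mathbf{L}(u)\|\,du\to 0$ along the path.
   Context: Let $\mathbf{U}=\{u_0,\dots,u_m\}$ be a non-decreasing sequence of real numbers (the knot vector), $p\ge 1$ the degree, and $p\le i\le m-p-1$ with $u_i<u_{i+1}$. The B-spline basis functions are defined by $N_{j,0}(u)=1$ if $u_j\le u<u_{j+1}$ and $0$ otherwise, and $N_{j,p}(u)=\frac{u-u_j}{u_{j+p}-u_j}N_{j,p-1}(u)+\frac{u_{j+p+1}-u}{u_{j+p+1}-u_{j+1}}N_{j+1,p-1}(u)$ with the convention $0/0=0$. On the closed interval $[u_i,u_{i+1}]$ the value of $N_{j,p}$ at $u_{i+1}$ is taken as the limit from the left. With control points $\mathbf{p}_j\in\mathbb{R}^d$ and weights $\omega_j>0$, the $p$th-degree NURBS curve on $[u_i,u_{i+1}]$ is $$\mathbf{C}(u)=\frac{\sum_{j=i-p}^{i}N_{j,p}(u)\,\omega_j\,\mathbf{p}_j}{\sum_{j=i-p}^{i}N_{j,p}(u)\,\omega_j},\qquad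 u\in[u_i,u_{i+1}].$$ Approach path with dominant index set $\mathbf{j}_0$: the weights are functions $\omega_j=\omega_j(t)>0$ of a real parameter $t\to+\infty$, and $\mathbf{j}_0\subseteq\{i-p,\dots,i\}$ is a nonempty set of indices such that, with $\lambda(t)=\min_{j\in\mathbf{j}_0}\omega_j(t)$, one has $\lambda(t)\to+\infty$; $\omega_j(t)/\lambda(t)\to k_j$ with $0<k_j<\infty$ for each $j\in\mathbf{j}_0$ (these weights have the same order of magnitude); and $\omega_j(t)/\lambda(t)\to 0$ for each $j\in\{i-p,\dots,i\}\setminus\mathbf{j}_0$ (the other weights are negligible). Convergence along the path means convergence as $t\to+\infty$. The control points and knots do not depend on $t$. *)

(* Defs.v *)
From HB Require Import structures.
From mathcomp Require Export all_boot all_order all_algebra.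
From mathcomp Require Export all_classical all_reals all_analysis.

Set Implicit Arguments.
Unset Strict Implicit.
Unset Printing Implicit Defensive.

Export Order.TTheory GRing.Theory Num.Theory.
Export numFieldNormedType.Exports.

#[global] Open Scope classical_set_scope.
#[global] Open Scope ring_scope.

(* The convention 0/0 = 0 is x / 0 = 0; for nondecreasing U, when a denominator
   vanishes, so does the B-spline factor next to it. *)
Fixpoint bspline (R : realType) (U : seq R) (p j : nat) (u : R) : R :=
  match p with
  | 0 => if U`_j <= u < U`_j.+1 then 1 else 0
  | q.+1 => (u - U`_j) / (U`_(j + p) - U`_j) * bspline U q j u
          + (U`_(j + p + 1) - u) / (U`_(j + p + 1) - U`_(j + 1))
              * bspline U q (j + 1) u
  end.

(* N_{j,p} on the closed knot span [U_i, U_(i+1)]: the half-open basis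
   functions are replaced at the right end by their limit from the left. *)
Definition bspline_span (R : realType) (U : seq R) (i p j : nat) (u : R) : R :=
  if u == U`_i.+1 then lim (bspline U p j x @[x --> (U`_i.+1)^'-])
  else bspline U p j u.

(* Only the control points and weights of index i - p, ..., i are used. *)
Definition nurbs (R : realType) (d : nat) (U : seq R) (i p : nat)
    (P : nat -> 'rV[R]_d) (w : nat -> R) (u : R) : 'rV[R]_d :=
  (\sum_(i - p <= j < i.+1) bspline_span U i p j u * w j)^-1 *:
  \sum_(i - p <= j < i.+1) (bspline_span U i p j u * w j) *: P j.

Definition is_minimum (R : realType) (A : set R) (x : R) : Prop :=
  A x /\ lbound A x.

(* w j t is the weight of index j at parameter t. The function lam is
   determined by w and J, as the minimum of finitely many values. *)
Definition approach_path (R : realType) (a b : nat) (w : nat -> R -> R)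
    (J : set nat) : Prop :=
  [/\ forall j t, (a <= j <= b)%N -> 0 < w j t,
      J !=set0,
      J `<=` [set j | (a <= j <= b)%N] &
      exists lam : R -> R,
        [/\ forall t, is_minimum [set w j t | j in J] (lam t),
            lam t @[t --> +oo] --> +oo,
            forall j, J j ->
              exists2 k : R, 0 < k & w j t / lam t @[t --> +oo] --> k &
            forall j, (a <= j <= b)%N -> ~ J j ->
              w j t / lam t @[t --> +oo] --> (0 : R)]].

(* The library's norm on row vectors is the sup norm. *)
Definition euclidean_norm (R : realType) (d : nat) (v : 'rV[R]_d) : R :=
  Num.sqrt (\sum_(k < d) v 0 k ^+ 2).

Definition integrable_rV (R : realType) (d : nat) (D : set R)
    (f : R -> 'rV[R]_d) : Prop :=
  forall k : 'I_d,
    (@lebesgue_measure R).-integrable D (fun u => (f u 0 k)%:E).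

(* Main.v *)
Require Import Defs.
From mathcomp Require Import all_boot all_order all_algebra.
From mathcomp Require Import all_classical all_reals all_analysis.
From mathcomp Require Import measurable_realfun lra zify.

(** The limit curve is the NURBS curve whose weights are the limits of the
    rescaled weights w j / lam: the k_j for j in J0, and 0 for the negligible
    indices. Indeed a NURBS point is a weighted mean of control points, with
    coefficients N_{j,p}(u) * w j, and a weighted mean does not change when all
    its coefficients are divided by lam ([weighted_mean_scale]).

    At a point u of the open span ]U_i, U_(i+1)[ every N_{j,p}(u) with
    i - p <= j <= i is positive ([bspline_sign_open_span]). The limit
    denominator, the sum of the N_{j,p}(u) * k_j over j in J0, is therefore
    nonzero, and the curve converges pointwise on the open span
    ([cvg_nurbs_coord]). The convergence need not be uniform, as all the
    N_{j,p} with j in J0 may vanish at an end of the span. But a weighted mean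
    with nonnegative coefficients is bounded by its data
    ([ler_norm_weighted_mean]), whatever the weights, so bounded convergence
    ([cvg_integral_bounded]) turns pointwise convergence on the open span into
    L^1 convergence; the two end points are negligible.

    Measurability comes from continuity on the open span. Continuity in u at
    fixed weights and convergence in the parameter at fixed u are both instances
    of the convergence of a weighted mean whose coefficients converge along an
    arbitrary filter ([cvg_weighted_mean]). *)

Set Implicit Arguments.
Unset Strict Implicit.
Unset Printing Implicit Defensive.

(** * Weighted means *)

Definition weighted_mean {R : realType} (s : seq nat) (c x : nat -> R) : R :=
  (\sum_(j <- s) c j)^-1 * \sum_(j <- s) c j * x j.

Lemma weighted_mean_scale (R : realType) (a : R) (s : seq nat)
    (c x : nat -> R) :
  a != 0 -> weighted_mean s (fun j => a * c j) x = weighted_mean s c x.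
Proof.
move=> a0; rewrite /weighted_mean -mulr_sumr.
under [X in _ * X]eq_bigr do rewrite -mulrA.
by rewrite -mulr_sumr invfM mulrACA mulVf// mul1r.
Qed.

(** The bound does not involve the coefficients, which is what makes it uniform
    along an approach path. The sum of the data stands in for their maximum:
    it dominates each of them. *)
Lemma ler_norm_weighted_mean (R : realType) (s : seq nat) (c x : nat -> R) :
  (forall j, j \in s -> 0 <= c j) ->
  `|weighted_mean s c x| <= \sum_(j <- s) `|x j|.
Proof.
move=> c0; have C0 : 0 <= \sum_(j <- s) c j.
  by rewrite big_seq; apply: sumr_ge0.
have X0 : 0 <= \sum_(j <- s) `|x j| by apply: sumr_ge0.
rewrite /weighted_mean normrM normfV (ger0_norm C0).
(* With zero total coefficient the mean is 0, by the convention 0^-1 = 0. *)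
have [->|Cn0] := eqVneq (\sum_(j <- s) c j) 0; first by rewrite invr0 mul0r.
rewrite mulrC ler_pdivrMr ?lt_def ?Cn0//.
apply: le_trans (ler_norm_sum _ _ _) _; rewrite mulr_sumr.
rewrite big_seq [leRHS]big_seq; apply: ler_sum => j js.
rewrite normrM (ger0_norm (c0 _ js)) mulrC ler_wpM2r ?c0//.
rewrite (perm_big _ (perm_to_rem js)) big_cons lerDl.
exact: sumr_ge0.
Qed.

(** The filter is left arbitrary so that the same fact gives continuity in the
    curve parameter and convergence along an approach path. *)
Lemma cvg_weighted_mean (R : realType) (T : Type) (F : set_system T)
    (s : seq nat) (c : nat -> T -> R) (l x : nat -> R) :
  Filter F ->
  (forall j, j \in s -> c j t @[t --> F] --> l j) ->
  \sum_(j <- s) l j != 0 ->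
  weighted_mean s (c ^~ t) x @[t --> F] --> weighted_mean s l x.
Proof.
move=> FF cl l0.
apply: cvgM.
  apply: cvgV => //; rewrite big_seq.
  under eq_fun do rewrite big_seq.
  exact: (cvg_big add_continuous).
rewrite big_seq; under eq_fun do rewrite big_seq.
apply: (cvg_big add_continuous) => // j js.
by apply: cvgM; [exact: cl|exact: cvg_cst].
Qed.

(** * B-splines on an open knot span *)

(** The support [U_j, U_(j+q+1)] of N_{j,q} contains the span exactly when
    j <= i <= j + q. In the recursion both terms are then nonnegative; at least
    one of the indices j, j + 1 keeps the span in its support, and its affine
    factor is positive because the knots next to u strictly separate it from the
    ends of that support. The two signs are proved together because the
    induction meets both. The bound on j + q keeps all knots used within the
    knot vector, beyond which [nth] would return 0 and break monotonicity. *)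
Lemma bspline_sign_open_span (R : realType) (U : seq R) (i q j : nat) (u : R) :
  sorted <=%R U -> U`_i < u < U`_i.+1 -> (j + q + 1 < size U)%N ->
  (i.+1 < size U)%N ->
  if (j <= i <= j + q)%N then is_true (0 < bspline U q j u)
  else bspline U q j u = 0.
Proof.
move=> sU /andP[iu ui] + im.
have U_le a b : (a <= b)%N -> (b < size U)%N -> U`_a <= U`_b.
  move=> ab bs; apply: (sorted_leq_nth le_trans lexx) => //.
  exact: leq_ltn_trans bs.
elim: q j => [|q IH] j jm.
  rewrite /= addn0; case: ifPn => [/andP[ji ij]|].
    have -> : j = i by lia.
    by rewrite (ltW iu) ui ltr01.
  rewrite negb_and -!ltnNge => /orP[ij|ji]; case: ifPn => // /andP[ju uj].
  - by have := U_le i.+1 j ij ltac:(lia); lra.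
  - by have := U_le j.+1 i ji ltac:(lia); lra.
have IH1 := IH j ltac:(lia); have IH2 := IH (j + 1)%N ltac:(lia).
rewrite [bspline U q.+1 j u]/=.
case: ifPn => [/andP[ji ij]|nji]; last first.
  rewrite ifF in IH1; last lia.
  rewrite ifF in IH2; last lia.
  by rewrite IH1 IH2 !mulr0 addr0.
have Uji := U_le j i ji ltac:(lia).
have Uij := U_le i.+1 (j + q.+1 + 1)%N ltac:(lia) jm.
have first_gt0 : (i <= j + q)%N ->
    0 < (u - U`_j) / (U`_(j + q.+1) - U`_j) * bspline U q j u.
  move=> ijq; rewrite ifT in IH1; last lia.
  have := U_le i.+1 (j + q.+1)%N ltac:(lia) ltac:(lia).
  by move=> ?; rewrite mulr_gt0// divr_gt0//; lra.
have second_gt0 : (j < i)%N ->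
    0 < (U`_(j + q.+1 + 1) - u) / (U`_(j + q.+1 + 1) - U`_(j + 1)) *
        bspline U q (j + 1) u.
  move=> jlti; rewrite ifT in IH2; last lia.
  have := U_le (j + 1)%N i ltac:(lia) ltac:(lia).
  by move=> ?; rewrite mulr_gt0// divr_gt0//; lra.
case: (leqP i (j + q)) => ijq; last first.
  rewrite ifF in IH1; last lia.
  by rewrite IH1 mulr0 add0r second_gt0//; lia.
case: (ltnP j i) => jlti; first by rewrite addr_gt0 ?first_gt0 ?second_gt0.
rewrite ifF in IH2; last lia.
by rewrite IH2 mulr0 addr0 first_gt0.
Qed.

(** Degree 0 basis functions are constant on the open span, and the recursion
    multiplies by affine functions of u only. *)
Lemma bspline_continuous_open_span (R : realType) (U : seq R) (i q j : nat)
    (u : R) :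
  sorted <=%R U -> U`_i < u < U`_i.+1 -> (j + q + 1 < size U)%N ->
  (i.+1 < size U)%N ->
  bspline U q j x @[x --> u] --> bspline U q j u.
Proof.
move=> sU uU + im; elim: q j => [|q IH] j jm.
  have base v : U`_i < v < U`_i.+1 -> bspline U 0 j v = (j == i)%:R.
    move=> vU; have := bspline_sign_open_span sU vU jm im.
    rewrite addn0 -eqn_leq /=.
    by case: eqP => [-> _|_]; [case/andP: vU => /ltW -> ->|].
  rewrite (base u)//; apply: cvg_near_cst.
  have : u \in `]U`_i, U`_i.+1[ by rewrite in_itv.
  by move/near_in_itvoo; apply: filterS => v; rewrite in_itv /= => /base.
have IH1 := IH j ltac:(lia); have IH2 := IH (j + 1)%N ltac:(lia).
rewrite [bspline _ _ _ u]/=; under eq_fun do rewrite [bspline _ _ _ _]/=.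
apply: cvgD; apply: cvgM => //; (apply: cvgM; last exact: cvg_cst).
  by apply: cvgB => //; exact: cvg_cst.
by apply: cvgB => //; exact: cvg_cst.
Qed.

(** * Integration over an interval, up to its end points *)

Lemma integrable_itvcc_bounded_itvoo (R : realType) (a b M : R) (f : R -> R) :
  measurable_fun `]a, b[ f -> (forall u, u \in `]a, b[ -> `|f u| <= M) ->
  (@lebesgue_measure R).-integrable `[a, b] (EFin \o f).
Proof.
move=> mf fM; apply: measurable_bounded_integrable => //.
- by rewrite /= lebesgue_measure_itv /=; case: ifP => // _; rewrite -EFinB ltry.
- exact: measurable_fun_itv_cc mf.
exists (`|M| + `|f a| + `|f b|); split; first exact: num_real.
have := (normr_ge0 (f a), normr_ge0 (f b), normr_ge0 M, ler_norm M).
move=> [[[fa0 fb0] M0] MM] x Mx u /=; rewrite in_itv /= => /andP[].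
rewrite le_eqVlt => /orP[/eqP <- _|au]; first lra.
rewrite le_eqVlt => /orP[/eqP ->|ub]; first lra.
by have := fM u; rewrite in_itv /= au ub => /(_ isT) ?; lra.
Qed.

(** Dominated convergence holds along sequences; the filter at infinity of the
    real line is countably generated, so testing along all sequences that tend
    to infinity suffices. Hypotheses on the open interval are enough, since its
    end points have measure zero. *)
Lemma cvg_integral_bounded (R : realType) (a b M : R) (g : R -> R -> R) :
  (forall t, measurable_fun `]a, b[ (g t)) ->
  (forall t u, u \in `]a, b[ -> `|g t u| <= M) ->
  (forall u, u \in `]a, b[ -> g t u @[t --> +oo] --> 0) ->
  (\int[lebesgue_measure]_(u in `[a, b]) (g t u)%:E)%E @[t --> +oo]
    --> 0%E.
Proof.
move=> mg gM g0; apply/cvge_pinftyP => v v_oo.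
under eq_fun => n.
  rewrite integral_itv_bndoo; last exact/measurable_EFinP.
  over.
rewrite -(integral0 lebesgue_measure `]a, b[%classic).
apply: (@dominated_cvg _ _ _ _ _ _ _ _ (cst M%:E)) => //.
- by move=> n; apply/(@measurable_EFinP _ R).
- move=> u uab; apply: cvg_EFin; first exact: nearW.
  exact: cvg_comp v_oo (g0 u uab).
- apply: (@measurable_bounded_integrable _ _ _ _ (cst M)) => //.
    by rewrite /= lebesgue_measure_itv /=; case: ifP => // _; rewrite -EFinB ltry.
  exists `|M|; split; first exact: num_real.
  by move=> x Mx u _ /=; exact: ltW.
- by move=> n u uab; rewrite lee_fin gM.
Qed.

(** * The Euclidean norm *)

Lemma cvg_euclidean_norm (R : realType) (d : nat) (T : Type)
    (F : set_system T) (v : T -> 'rV[R]_d) (l : 'rV[R]_d) :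
  Filter F -> (forall k, v t 0 k @[t --> F] --> l 0 k) ->
  euclidean_norm (v t) @[t --> F] --> euclidean_norm l.
Proof.
move=> FF vl; apply: (@cvg_comp _ _ _ (fun t => \sum_(k < d) v t 0 k ^+ 2)
  (@Num.sqrt R)); last exact: realfun.sqrt_continuous.
apply: (cvg_big add_continuous) => k _.
under eq_fun do rewrite expr2.
by rewrite expr2; apply: cvgM; exact: vl.
Qed.

Lemma euclidean_norm_le_sum (R : realType) (d : nat) (v : 'rV[R]_d) :
  euclidean_norm v <= \sum_(k < d) `|v 0 k|.
Proof.
have S0 : 0 <= \sum_(k < d) `|v 0 k| by apply: sumr_ge0.
rewrite -(ger0_norm S0) -sqrtr_sqr ler_sqrt ?sqr_ge0//.
rewrite expr2 mulr_suml; apply: ler_sum => k _.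
rewrite -real_normK ?num_real// expr2 ler_wpM2l//.
by rewrite (bigD1 k)//= lerDl sumr_ge0.
Qed.

(** * NURBS curves on an open knot span *)

Section OpenSpan.
Context {R : realType} {d : nat}.
Variables (U : seq R) (i p : nat) (P : nat -> 'rV[R]_d).
Hypotheses (sU : sorted <=%R U) (pi : (p <= i)%N)
  (im : (i + p + 1 < size U)%N).

Let s := index_iota (i - p) i.+1.

(** Away from the right end of the span, where the basis functions are redefined
    by a left limit. *)
Lemma nurbs_coord (w : nat -> R) (u : R) (k : 'I_d) : u < U`_i.+1 ->
  nurbs U i p P w u 0 k =
  weighted_mean s (fun j => bspline U p j u * w j) (fun j => P j 0 k).
Proof.
move=> ui; rewrite /nurbs /bspline_span lt_eqF// mxE summxE.
by congr (_ * _); apply: eq_bigr => j _; rewrite mxE.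
Qed.

Lemma bspline_span_gt0 (u : R) (j : nat) :
  U`_i < u < U`_i.+1 -> j \in s -> 0 < bspline U p j u.
Proof.
move=> uU; rewrite mem_index_iota => js.
by have := @bspline_sign_open_span _ U i p j u sU uU ltac:(lia) ltac:(lia);
  rewrite ifT//; lia.
Qed.

(** One positive weight suffices, since no basis function of the span vanishes
    inside it. This is what keeps the limit denominator, where negligible
    weights have become 0, away from 0. *)
Lemma sum_bspline_span_gt0 (w : nat -> R) (u : R) : U`_i < u < U`_i.+1 ->
  (forall j, j \in s -> 0 <= w j) -> (exists2 j, j \in s & 0 < w j) ->
  0 < \sum_(j <- s) bspline U p j u * w j.
Proof.
move=> uU w0 [j js wj]; rewrite (perm_big _ (perm_to_rem js)) big_cons.
rewrite ltr_pwDl ?mulr_gt0 ?bspline_span_gt0// big_seq sumr_ge0// => h hs.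
by have {}hs := mem_rem hs; rewrite mulr_ge0 ?w0// ltW ?bspline_span_gt0.
Qed.

Lemma ler_norm_nurbs_coord (w : nat -> R) (u : R) (k : 'I_d) :
  U`_i < u < U`_i.+1 -> (forall j, j \in s -> 0 <= w j) ->
  `|nurbs U i p P w u 0 k| <= \sum_(j <- s) `|P j 0 k|.
Proof.
move=> uU w0; rewrite nurbs_coord; last by case/andP: uU.
apply: ler_norm_weighted_mean => j js.
by rewrite mulr_ge0 ?w0// ltW ?bspline_span_gt0.
Qed.

Lemma nurbs_coord_continuous (w : nat -> R) (u : R) (k : 'I_d) :
  U`_i < u < U`_i.+1 ->
  (forall j, j \in s -> 0 <= w j) -> (exists2 j, j \in s & 0 < w j) ->
  nurbs U i p P w x 0 k @[x --> u] --> nurbs U i p P w u 0 k.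
Proof.
move=> uU w0 w1; rewrite nurbs_coord; last by case/andP: uU.
apply: cvg_trans (cvg_weighted_mean
  (c := fun j x => bspline U p j x * w j) (nbhs_filter u) _ _).
- apply: near_eq_cvg.
  have : u \in `]U`_i, U`_i.+1[ by rewrite in_itv.
  move/near_in_itvoo; apply: filterS => v; rewrite in_itv /= => /andP[_ ?].
  by rewrite nurbs_coord.
- move=> j; rewrite mem_index_iota => js; apply: cvgM; last exact: cvg_cst.
  by apply: bspline_continuous_open_span uU _ _ => //; lia.
- by rewrite gt_eqF// sum_bspline_span_gt0.
Qed.

(** The weights themselves may diverge: only their ratios to lam have to
    converge, because the curve does not see a common factor. *)
Lemma cvg_nurbs_coord (T : Type) (F : set_system T) (w : nat -> T -> R)
    (lam : T -> R) (l : nat -> R) (u : R) (k : 'I_d) :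
  Filter F -> U`_i < u < U`_i.+1 -> (forall t, lam t != 0) ->
  (forall j, j \in s -> w j t / lam t @[t --> F] --> l j) ->
  (forall j, j \in s -> 0 <= l j) -> (exists2 j, j \in s & 0 < l j) ->
  nurbs U i p P (w ^~ t) u 0 k @[t --> F] --> nurbs U i p P l u 0 k.
Proof.
move=> FF uU lam0 wl l0 l1; have ui : u < U`_i.+1 by case/andP: uU.
rewrite nurbs_coord//; under eq_fun => t.
  rewrite nurbs_coord// -(weighted_mean_scale (a := (lam t)^-1)) ?invr_eq0//.
  under eq_fun do rewrite mulrC -mulrA.
  over.
apply: (cvg_weighted_mean (c := fun j t => bspline U p j u * (w j t / lam t))).
- by move=> j js; apply: cvgM; [exact: cvg_cst|exact: wl].
- by rewrite gt_eqF// sum_bspline_span_gt0.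
Qed.

End OpenSpan.

(** * Convergence in mean along an approach path *)

Theorem theorem4 (R : realType) (d m p i : nat)
    (U : m.+1.-tuple R) (P : nat -> 'rV[R]_d)
    (w : nat -> R -> R) (J0 : set nat) :
  sorted <=%R U ->
  (1 <= p)%N ->
  (p <= i)%N -> (i + p + 1 <= m)%N ->
  U`_i < U`_i.+1 ->
  approach_path (i - p) i w J0 ->
  exists L : R -> 'rV[R]_d,
    integrable_rV `[U`_i, U`_i.+1] L /\
    (\int[lebesgue_measure]_(u in `[U`_i, U`_i.+1])
       (euclidean_norm (nurbs U i p P (fun j => w j t) u - L u))%:E)%E
      @[t --> +oo%R] --> 0%E.
Proof.
move=> sU _ pi im _ [w_gt0 [j0 J0j0] J0_range [lam [lam_min _ w_J0 w_nJ0]]].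
have {}im : (i + p + 1 < size U)%N by rewrite size_tuple ltnS.
have lam_neq0 t : lam t != 0.
  have [[j /J0_range jr <-] _] := lam_min t.
  by rewrite gt_eqF// w_gt0.
(* The limit weights; those of the negligible indices are 0. *)
have /choice[K K_spec] : forall j, exists k : R,
    [/\ (i - p <= j <= i)%N -> w j t / lam t @[t --> +oo] --> k,
        0 <= k & J0 j -> 0 < k].
  move=> j; have [J0j|nJ0j] := pselect (J0 j).
    by have [k k_gt0 wk] := w_J0 j J0j; exists k; split=> //; exact: ltW.
  by exists 0; split=> // jr; exact: w_nJ0.
set s := index_iota (i - p) i.+1.
have sE j : j \in s = (i - p <= j <= i)%N by rewrite mem_index_iota ltnS.
have K_ge0 j : j \in s -> 0 <= K j by move=> _; have [] := K_spec j.
have K_gt0 : exists2 j, j \in s & 0 < K j.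
  by exists j0; [rewrite sE; exact: J0_range|have [_ _] := K_spec j0; apply].
have w_ge0 t j : j \in s -> 0 <= w j t by rewrite sE => /w_gt0/ltW.
have w_pos t : exists2 j, j \in s & 0 < w j t.
  by exists j0; [rewrite sE|apply: w_gt0]; exact: J0_range.
have subE (x y : 'rV[R]_d) k : (x - y) 0 k = x 0 k - y 0 k by rewrite !mxE.
pose B (k : 'I_d) := \sum_(j <- s) `|P j 0 k|.
exists (nurbs U i p P K); split.
  move=> k; apply: (@integrable_itvcc_bounded_itvoo _ _ _ (B k)).
    apply: open_continuous_measurable_fun => // u.
    rewrite inE /= in_itv /= => uU.
    exact: nurbs_coord_continuous.
  by move=> u; rewrite in_itv /= => uU; exact: ler_norm_nurbs_coord.
apply: (@cvg_integral_bounded _ _ _ (\sum_k (B k + B k))).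
- move=> t; apply: open_continuous_measurable_fun => // u.
  rewrite inE /= in_itv /= => uU; apply: cvg_euclidean_norm => k.
  under eq_fun do rewrite subE; rewrite subE.
  apply: cvgB; last exact: nurbs_coord_continuous.
  by apply: nurbs_coord_continuous => //; exact: w_ge0.
- move=> t u; rewrite in_itv /= => uU.
  rewrite ger0_norm ?sqrtr_ge0//; apply: le_trans (euclidean_norm_le_sum _) _.
  apply: ler_sum => k _; rewrite subE; apply: le_trans (ler_normB _ _) _.
  by apply: lerD; apply: ler_norm_nurbs_coord => //; exact: w_ge0.
- move=> u; rewrite in_itv /= => uU.
  have -> : 0 = euclidean_norm (0 : 'rV[R]_d).
    by rewrite /euclidean_norm big1 ?sqrtr0// => k _; rewrite mxE expr0n.
  apply: cvg_euclidean_norm => k; rewrite mxE.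
  rewrite -(subrr (nurbs U i p P K u 0 k)).
  under eq_fun do rewrite subE.
  apply: cvgB; last exact: cvg_cst.
  apply: (cvg_nurbs_coord _ _ _ _ _ lam_neq0) => // j; rewrite sE.
  by have [] := K_spec j.
Qed.
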